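(* Let $N=\mathbb R^3$ with coordinates $(x,y,\theta)$, let $\mathcal N$ be the distribution spanned by $n_1=\partial_\theta$ and $n_2=\partial_x+\theta\,\partial_y$, and let $r=dx^2+d\theta^2$ be the sub-Riemannian metric on $\mathcal N$ for which $n_1,n_2$ are orthonormal. The infinitesimal symmetries of the left-invariant sub-Riemannian structure $(N,\mathcal N,r)$ form a Lie algebra generated (over $\mathbb R$, as a vector space) by the vector fields $$t_0=\theta\,\partial_x+\tfrac{\theta^2-x^2}{2}\,\partial_y-x\,\partial_\theta,\qquad t_1=\partial_x,\qquad t_2=x\,\partial_y+\partial_\theta,\qquad t_3=\partial_y .$$ In particular, $t_0$ generates the isotropy subalgebra at $(0,0,0)$ (the infinitesimal symmetries vanishing at $(0,0,0)$). The fields $t_1,t_2,t_3$ are translations that reflect the Heisenberg structure and coincide with the right-invariant vector fields $\partial_x$, $\partial_\theta+x\,\partial_y$, $\partial_y$ of the Lie group $N$.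
   Context: The Lie group structure on $N$ is the Heisenberg group law which, in the coordinate order $(\theta,x,y)$, reads $(\theta,x,y)\circ(\tilde\theta,\tilde x,\tilde y)=(\theta+\tilde\theta,\;x+\tilde x,\;y+\tilde y+\theta\tilde x)$; the fields $n_1,n_2$ and $n_3=[n_1,n_2]=\partial_y$ are left-invariant. An infinitesimal symmetry of $(N,\mathcal N,r)$ is a smooth vector field $v$ on $N$ whose flow preserves the structure, i.e. $\mathcal L_v(\mathcal N)\subset\mathcal N$ and $\mathcal L_v(r)=0$, where $\mathcal L$ is the Lie derivative. *)

(* Defs.v *)
From Stdlib Require Import Reals.
From Coquelicot Require Import Coquelicot.
Open Scope R_scope.

(** Coordinates are ordered [(x, y, theta)]; tangent vectors at any point are
    given by their components along [d/dx], [d/dy], [d/dtheta] in this order. *)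
Definition R3 := (R * R * R)%type.

Definition cx (p : R3) : R := fst (fst p).
Definition cy (p : R3) : R := snd (fst p).
Definition cth (p : R3) : R := snd p.

Definition vfield := R3 -> R3.

(** * Calculus on [R3] *)

Definition slice_x (f : R3 -> R) (p : R3) (s : R) : R := f (s, cy p, cth p).
Definition slice_y (f : R3 -> R) (p : R3) (s : R) : R := f (cx p, s, cth p).
Definition slice_th (f : R3 -> R) (p : R3) (s : R) : R := f (cx p, cy p, s).

Definition partial_x (f : R3 -> R) (p : R3) : R := Derive (slice_x f p) (cx p).
Definition partial_y (f : R3 -> R) (p : R3) : R := Derive (slice_y f p) (cy p).
Definition partial_th (f : R3 -> R) (p : R3) : R := Derive (slice_th f p) (cth p).

Fixpoint Ck (k : nat) (f : R3 -> R) : Prop :=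
  (forall p : R3, continuous f p) /\
  match k with
  | O => True
  | S k' =>
      (forall p : R3, ex_derive (slice_x f p) (cx p) /\
                      ex_derive (slice_y f p) (cy p) /\
                      ex_derive (slice_th f p) (cth p)) /\
      Ck k' (partial_x f) /\ Ck k' (partial_y f) /\ Ck k' (partial_th f)
  end.

Definition smooth (f : R3 -> R) : Prop := forall k : nat, Ck k f.

Definition smooth_field (v : vfield) : Prop :=
  smooth (fun p => cx (v p)) /\ smooth (fun p => cy (v p)) /\
  smooth (fun p => cth (v p)).

(** [differential f p xi] is [df_p(xi)] and [Tmap F p xi] is [dF_p(xi)], computed from the
    partial derivatives; both are meaningful for smooth [f] and [F] only. *)
Definition differential (f : R3 -> R) (p xi : R3) : R :=
  cx xi * partial_x f p + cy xi * partial_y f p + cth xi * partial_th f p.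

Definition Tmap (F : R3 -> R3) (p xi : R3) : R3 :=
  (differential (fun q => cx (F q)) p xi, differential (fun q => cy (F q)) p xi,
   differential (fun q => cth (F q)) p xi).

(** * Vector fields *)

Definition vzero : vfield := fun _ => zero.
Definition vplus (v w : vfield) : vfield := fun p => plus (v p) (w p).
Definition vscal (c : R) (v : vfield) : vfield := fun p => scal c (v p).

(** In coordinates [[v,w]^i = v(w^i) - w(v^i)]. *)
Definition bracket (v w : vfield) : vfield :=
  fun p => minus (Tmap w p (v p)) (Tmap v p (w p)).

Record lie_algebra (S : vfield -> Prop) : Prop := {
  lie_zero : S vzero;
  lie_plus : forall v w, S v -> S w -> S (vplus v w);
  lie_scal : forall c v, S v -> S (vscal c v);
  lie_bracket : forall v w, S v -> S w -> S (bracket v w);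
  lie_linear_l : forall a b u v w, S u -> S v -> S w -> forall p,
    bracket (vplus (vscal a u) (vscal b v)) w p =
    vplus (vscal a (bracket u w)) (vscal b (bracket v w)) p;
  lie_linear_r : forall a b u v w, S u -> S v -> S w -> forall p,
    bracket w (vplus (vscal a u) (vscal b v)) p =
    vplus (vscal a (bracket w u)) (vscal b (bracket w v)) p;
  lie_alternating : forall v, S v -> forall p, bracket v v p = zero;
  lie_jacobi : forall u v w, S u -> S v -> S w -> forall p,
    vplus (vplus (bracket u (bracket v w)) (bracket v (bracket w u)))
          (bracket w (bracket u v)) p = zero
}.

(** * Sub-Riemannian structures and their infinitesimal symmetries *)

(** [D p xi] says that [xi] lies in the fibre of the distribution at [p]. *)
Definition distribution := R3 -> R3 -> Prop.

(** [r p xi eta] is only meaningful for [xi], [eta] in the fibre at [p]. *)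
Definition metric := R3 -> R3 -> R3 -> R.

Definition smooth_section (D : distribution) (w : vfield) : Prop :=
  smooth_field w /\ forall p, D p (w p).

Definition lie_derivative_metric (v : vfield) (r : metric) (w1 w2 : vfield)
    (p : R3) : R :=
  differential (fun q => r q (w1 q) (w2 q)) p (v p)
  - r p (bracket v w1 p) (w2 p) - r p (w1 p) (bracket v w2 p).

Definition infinitesimal_symmetry (D : distribution) (r : metric) (v : vfield)
    : Prop :=
  smooth_field v /\
  (forall w, smooth_section D w -> smooth_section D (bracket v w)) /\
  (forall w1 w2, smooth_section D w1 -> smooth_section D w2 ->
     forall p, lie_derivative_metric v r w1 w2 p = 0).

Definition isotropy (D : distribution) (r : metric) (p : R3) (v : vfield)
    : Prop :=
  infinitesimal_symmetry D r v /\ v p = zero.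

(** * The structure on the Heisenberg group *)

Definition d_x : vfield := fun _ => (1, 0, 0).
Definition d_y : vfield := fun _ => (0, 1, 0).
Definition d_th : vfield := fun _ => (0, 0, 1).

Definition n1 : vfield := d_th.
Definition n2 : vfield := fun p => plus (d_x p) (scal (cth p) (d_y p)).

Definition heis_D : distribution :=
  fun p xi => exists a b : R, xi = plus (scal a (n1 p)) (scal b (n2 p)).

(** [dx^2 + dtheta^2] *)
Definition heis_r : metric :=
  fun _ xi eta => cx xi * cx eta + cth xi * cth eta.

(** In the order [(theta, x, y)] this is
    [(th, x, y) o (th', x', y') = (th + th', x + x', y + y' + th * x')]. *)
Definition heis_mul (p q : R3) : R3 :=
  (cx p + cx q, cy p + cy q + cth p * cx q, cth p + cth q).

Definition left_invariant (v : vfield) : Prop :=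
  forall g p, Tmap (fun q => heis_mul g q) p (v p) = v (heis_mul g p).

Definition right_invariant (v : vfield) : Prop :=
  forall g p, Tmap (fun q => heis_mul q g) p (v p) = v (heis_mul p g).

(** The flow of [v] consists of the left translations by the elements of a
    one-parameter subgroup. *)
Definition generates_translations (v : vfield) : Prop :=
  exists gamma : R -> R3,
    gamma 0 = (0, 0, 0) /\
    (forall s s', gamma (s + s') = heis_mul (gamma s) (gamma s')) /\
    (forall p s, is_derive (fun u => heis_mul (gamma u) p) s
                           (v (heis_mul (gamma s) p))).

Definition t0 : vfield := fun p =>
  plus (plus (scal (cth p) (d_x p))
             (scal ((cth p ^ 2 - cx p ^ 2) / 2) (d_y p)))
       (scal (- cx p) (d_th p)).
Definition t1 : vfield := d_x.
Definition t2 : vfield := fun p => plus (scal (cx p) (d_y p)) (d_th p).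
Definition t3 : vfield := d_y.

Ltac heis_calc :=
  cbv -[Rplus Rmult Ropp Rminus Rinv Rdiv IZR Derive];
  repeat match goal with
  | |- context [Derive ?f ?x] =>
      let E := fresh in
      eassert (E : Derive f x = _) by
        (apply is_derive_unique; auto_derive; [exact I | reflexivity]);
      rewrite E; clear E
  end;
  repeat apply (f_equal2 pair); field.

Lemma n1_n2_orthonormal (p : R3) :
  heis_r p (n1 p) (n1 p) = 1 /\ heis_r p (n2 p) (n2 p) = 1 /\
  heis_r p (n1 p) (n2 p) = 0.
Proof. repeat split; destruct p as [[x y] th]; heis_calc. Qed.

Lemma bracket_n1_n2 (p : R3) : bracket n1 n2 p = d_y p.
Proof. destruct p as [[x y] th]; heis_calc. Qed.

Lemma n_left_invariant :
  left_invariant n1 /\ left_invariant n2 /\ left_invariant d_y.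
Proof.
repeat split; intros [[gx gy] gt] [[x y] th]; heis_calc.
Qed.

(* Main.v *)
From Stdlib Require Import Reals Lra FunctionalExtensionality.
From Coquelicot Require Import Coquelicot.
Require Import Defs.
Open Scope R_scope.

(** Testing the symmetry condition on the sections [n1] and [n2] alone already
    turns it into a linear system of partial differential equations.  Write
    [v = (a, b, c)] in the order [(x, y, theta)], and let [X = d_x + theta d_y]
    be the derivative along [n2].  Preserving the distribution and the inner
    products of the frame gives
      [c_theta = 0],  [X a = 0],  [a_theta + X c = 0],
      [b_theta = theta a_theta],  [X b = c].
    The contact Hamiltonian [f = b - theta a] then satisfies [f_theta = - a]
    and [X f = c], and the commutator [[d_theta, X] = d_y] yields
    [f_y = c_theta + X a = 0].  Together with the symmetry of second
    derivatives this removes every dependence on [y], and what remains,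
    [a = a(theta)], [c = c(x)] and [a' = - c'], forces both derivatives to be
    constant.  So the partial derivatives of [v] are those of an explicit
    quadratic field ([killing_partials]), and [v] is determined by a rotation
    rate and its value at the origin ([killing_solution]).

    Conversely, the Leibniz rule shows that these fields are symmetries with
    respect to all sections ([killing_symmetry]): their horizontal part is an
    infinitesimal Euclidean motion of the [(x, theta)]-plane, whose linear part
    is skew, and the [y]-component is the matching lift.

    The symmetries are thus a four-dimensional space of explicit fields, on
    which the bracket is given by structure constants ([killing_bracket]); the
    Lie algebra axioms and the isotropy statement become identities between
    coefficients.  Finally, the differential of right translation at the
    identity gives the right-invariant fields as the members of this family
    without rotation ([right_invariant_iff]), and [t1], [t2], [t3] are
    generated by left translation along straight lines. *)

(** * Partial derivatives and smooth functions *)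

Definition has_partials (f : R3 -> R) (p : R3) : Prop :=
  ex_derive (slice_x f p) (cx p) /\ ex_derive (slice_y f p) (cy p) /\
  ex_derive (slice_th f p) (cth p).

Lemma Ck_pred k f : Ck (S k) f -> Ck k f.
Proof.
revert f; induction k as [|k IH]; intros f (cf & df & fx & fy & ft).
- split; [exact cf | exact I].
- split; [exact cf|]; split; [exact df|].
  repeat split; apply IH; assumption.
Qed.

Lemma smooth_continuous f p : smooth f -> continuous f p.
Proof. intros sf; exact (proj1 (sf O) p). Qed.

Lemma smooth_has_partials f p : smooth f -> has_partials f p.
Proof. intros sf; exact (proj1 (proj2 (sf 1%nat)) p). Qed.

Lemma smooth_partial_x f : smooth f -> smooth (partial_x f).
Proof. intros sf k; destruct (sf (S k)) as (_ & _ & h & _ & _); exact h. Qed.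

Lemma smooth_partial_y f : smooth f -> smooth (partial_y f).
Proof. intros sf k; destruct (sf (S k)) as (_ & _ & _ & h & _); exact h. Qed.

Lemma smooth_partial_th f : smooth f -> smooth (partial_th f).
Proof. intros sf k; destruct (sf (S k)) as (_ & _ & _ & _ & h); exact h. Qed.

(** The rules for partial derivatives carry existence along with the values,
    since the induction on [k] in the closure properties of [Ck] needs both. *)
Lemma partials_const c p :
  has_partials (fun _ => c) p /\ partial_x (fun _ => c) p = 0 /\
  partial_y (fun _ => c) p = 0 /\ partial_th (fun _ => c) p = 0.
Proof.
split; [repeat split; exact (ex_derive_const _ _)|].
repeat split; exact (Derive_const _ _).
Qed.

Lemma partials_cx p :
  has_partials cx p /\ partial_x cx p = 1 /\ partial_y cx p = 0 /\
  partial_th cx p = 0.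
Proof.
split; [repeat split; first [exact (ex_derive_id _) | exact (ex_derive_const _ _)]|].
repeat split; first [exact (Derive_id _) | exact (Derive_const _ _)].
Qed.

Lemma partials_cth p :
  has_partials cth p /\ partial_x cth p = 0 /\ partial_y cth p = 0 /\
  partial_th cth p = 1.
Proof.
split; [repeat split; first [exact (ex_derive_id _) | exact (ex_derive_const _ _)]|].
repeat split; first [exact (Derive_id _) | exact (Derive_const _ _)].
Qed.

Lemma partials_plus f g p :
  has_partials f p -> has_partials g p ->
  has_partials (fun q => f q + g q) p /\
  partial_x (fun q => f q + g q) p = partial_x f p + partial_x g p /\
  partial_y (fun q => f q + g q) p = partial_y f p + partial_y g p /\
  partial_th (fun q => f q + g q) p = partial_th f p + partial_th g p.
Proof.
intros (fx & fy & ft) (gx & gy & gt).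
split; [repeat split; apply @ex_derive_plus; assumption|].
repeat split; apply Derive_plus; assumption.
Qed.

Lemma partials_mult f g p :
  has_partials f p -> has_partials g p ->
  has_partials (fun q => f q * g q) p /\
  partial_x (fun q => f q * g q) p = partial_x f p * g p + f p * partial_x g p /\
  partial_y (fun q => f q * g q) p = partial_y f p * g p + f p * partial_y g p /\
  partial_th (fun q => f q * g q) p = partial_th f p * g p + f p * partial_th g p.
Proof.
destruct p as [[x y] th]; intros (fx & fy & ft) (gx & gy & gt).
split; [repeat split; apply ex_derive_mult; assumption|].
repeat split.
- exact (Derive_mult _ _ _ fx gx).
- exact (Derive_mult _ _ _ fy gy).
- exact (Derive_mult _ _ _ ft gt).
Qed.

Lemma Ck_const k c : Ck k (fun _ => c).
Proof.
revert c; induction k as [|k IH]; intros c;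
  (split; [intros p; apply continuous_const|]); [exact I|].
split; [intros p; apply (partials_const c p)|].
repeat split;
  [replace (partial_x (fun _ => c)) with (fun _ : R3 => 0)
  |replace (partial_y (fun _ => c)) with (fun _ : R3 => 0)
  |replace (partial_th (fun _ => c)) with (fun _ : R3 => 0)];
  try apply IH; extensionality p; symmetry; apply (partials_const c p).
Qed.

Lemma smooth_const c : smooth (fun _ => c).
Proof. intros k; apply Ck_const. Qed.

Lemma smooth_cx : smooth cx.
Proof.
assert (cc : forall p : R3, continuous cx p).
{ intros [[x y] th]; unfold cx.
  apply (continuous_comp fst fst); apply continuous_fst. }
intros [|k]; (split; [exact cc|]); [exact I|].
split; [intros p; apply (partials_cx p)|].
repeat split;
  [replace (partial_x cx) with (fun _ : R3 => 1)
  |replace (partial_y cx) with (fun _ : R3 => 0)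
  |replace (partial_th cx) with (fun _ : R3 => 0)];
  try apply Ck_const; extensionality p; symmetry; apply (partials_cx p).
Qed.

Lemma smooth_cth : smooth cth.
Proof.
assert (cc : forall p : R3, continuous cth p).
{ intros [[x y] th]; apply continuous_snd. }
intros [|k]; (split; [exact cc|]); [exact I|].
split; [intros p; apply (partials_cth p)|].
repeat split;
  [replace (partial_x cth) with (fun _ : R3 => 0)
  |replace (partial_y cth) with (fun _ : R3 => 0)
  |replace (partial_th cth) with (fun _ : R3 => 1)];
  try apply Ck_const; extensionality p; symmetry; apply (partials_cth p).
Qed.

Lemma Ck_plus k f g : Ck k f -> Ck k g -> Ck k (fun p => f p + g p).
Proof.
revert f g; induction k as [|k IH]; intros f g Cf Cg;
  (split; [intros p;
    exact (continuous_plus f g p (proj1 Cf p) (proj1 Cg p))|]); [exact I|].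
destruct Cf as (_ & df & fx & fy & ft), Cg as (_ & dg & gx & gy & gt).
assert (D := fun p => partials_plus f g p (df p) (dg p)).
split; [intros p; apply D|].
repeat split;
  [replace (partial_x _) with (fun p => partial_x f p + partial_x g p)
  |replace (partial_y _) with (fun p => partial_y f p + partial_y g p)
  |replace (partial_th _) with (fun p => partial_th f p + partial_th g p)];
  try (apply IH; assumption); extensionality p; symmetry; apply D.
Qed.

(** The factors themselves reappear in the derivatives of the product, so the
    induction also needs them in the smaller class: hence [Ck_pred]. *)
Lemma Ck_mult k f g : Ck k f -> Ck k g -> Ck k (fun p => f p * g p).
Proof.
revert f g; induction k as [|k IH]; intros f g Cf Cg;
  (split; [intros p;
    exact (continuous_mult f g p (proj1 Cf p) (proj1 Cg p))|]); [exact I|].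
assert (Cf' := Ck_pred _ _ Cf); assert (Cg' := Ck_pred _ _ Cg).
destruct Cf as (_ & df & fx & fy & ft), Cg as (_ & dg & gx & gy & gt).
assert (D := fun p => partials_mult f g p (df p) (dg p)).
split; [intros p; apply D|].
repeat split;
  [replace (partial_x _)
     with (fun p => partial_x f p * g p + f p * partial_x g p)
  |replace (partial_y _)
     with (fun p => partial_y f p * g p + f p * partial_y g p)
  |replace (partial_th _)
     with (fun p => partial_th f p * g p + f p * partial_th g p)];
  try (apply Ck_plus; apply IH; assumption); extensionality p; symmetry; apply D.
Qed.

Lemma smooth_plus f g : smooth f -> smooth g -> smooth (fun p => f p + g p).
Proof. intros sf sg k; apply Ck_plus; auto. Qed.

Lemma smooth_mult f g : smooth f -> smooth g -> smooth (fun p => f p * g p).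
Proof. intros sf sg k; apply Ck_mult; auto. Qed.

Lemma smooth_ext f g : (forall p, f p = g p) -> smooth f -> smooth g.
Proof. intros e; replace g with f; [tauto | extensionality p; apply e]. Qed.

Lemma smooth_minus f g : smooth f -> smooth g -> smooth (fun p => f p - g p).
Proof.
intros sf sg; apply smooth_ext with (fun p => f p + -1 * g p).
- intros p; ring.
- apply smooth_plus; [|apply smooth_mult]; auto using smooth_const.
Qed.

(** * Differentials and brackets *)

Lemma R3_eq (p q : R3) : cx p = cx q -> cy p = cy q -> cth p = cth q -> p = q.
Proof.
destruct p as [[x y] th], q as [[x' y'] th']; cbn; intros -> -> ->; reflexivity.
Qed.

Lemma smooth_differential f v :
  smooth f -> smooth_field v -> smooth (fun p => differential f p (v p)).
Proof.
intros sf (vx & vy & vt); unfold differential.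
repeat apply smooth_plus; apply smooth_mult;
  auto using smooth_partial_x, smooth_partial_y, smooth_partial_th.
Qed.

Lemma smooth_field_bracket v w :
  smooth_field v -> smooth_field w -> smooth_field (bracket v w).
Proof.
intros sv sw; pose proof sv as (vx & vy & vt); pose proof sw as (wx & wy & wt).
repeat split.
- apply (smooth_minus (fun p => differential (fun q => cx (w q)) p (v p))
    (fun p => differential (fun q => cx (v q)) p (w p)));
    apply smooth_differential; assumption.
- apply (smooth_minus (fun p => differential (fun q => cy (w q)) p (v p))
    (fun p => differential (fun q => cy (v q)) p (w p)));
    apply smooth_differential; assumption.
- apply (smooth_minus (fun p => differential (fun q => cth (w q)) p (v p))
    (fun p => differential (fun q => cth (v q)) p (w p)));
    apply smooth_differential; assumption.
Qed.

Lemma differential_plus f g p xi :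
  smooth f -> smooth g ->
  differential (fun q => f q + g q) p xi =
  differential f p xi + differential g p xi.
Proof.
intros sf sg.
destruct (partials_plus f g p (smooth_has_partials _ p sf)
            (smooth_has_partials _ p sg)) as (_ & ex & ey & et).
unfold differential; rewrite ex, ey, et; ring.
Qed.

Lemma differential_mult f g p xi :
  smooth f -> smooth g ->
  differential (fun q => f q * g q) p xi =
  differential f p xi * g p + f p * differential g p xi.
Proof.
intros sf sg.
destruct (partials_mult f g p (smooth_has_partials _ p sf)
            (smooth_has_partials _ p sg)) as (_ & ex & ey & et).
unfold differential; rewrite ex, ey, et; ring.
Qed.

Lemma differential_const c p xi : differential (fun _ => c) p xi = 0.
Proof.
destruct (partials_const c p) as (_ & ex & ey & et).
unfold differential; rewrite ex, ey, et; ring.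
Qed.

Lemma differential_cth p xi : differential cth p xi = cth xi.
Proof.
destruct (partials_cth p) as (_ & ex & ey & et).
unfold differential; rewrite ex, ey, et; ring.
Qed.

(** * Symmetry of second derivatives *)

Lemma continuous_pair {U V W : UniformSpace} (f : U -> V) (g : U -> W) x :
  continuous f x -> continuous g x -> continuous (fun u => (f u, g u)) x.
Proof.
intros cf cg; apply (continuous_comp_2 f g pair); [exact cf | exact cg |].
apply (continuous_ext (fun z => z)); [intros []; reflexivity|].
apply continuous_id.
Qed.

(** Carries continuity on [R3] over to the coordinate planes, where the
    two-variable theorem on mixed derivatives applies. *)
Lemma continuity_2d_pt_comp3 (f : R3 -> R) (g h k : R -> R -> R) x y :
  continuity_2d_pt g x y -> continuity_2d_pt h x y -> continuity_2d_pt k x y ->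
  continuous f (g x y, h x y, k x y) ->
  continuity_2d_pt (fun u v => f (g u v, h u v, k u v)) x y.
Proof.
intros cg ch ck cf; apply continuity_2d_pt_filterlim.
apply continuity_2d_pt_filterlim in cg, ch, ck.
apply (continuous_comp (fun z : R * R =>
  (g (fst z) (snd z), h (fst z) (snd z), k (fst z) (snd z))) f (x, y)).
- apply continuous_pair; [apply continuous_pair|]; assumption.
- exact cf.
Qed.

Lemma partial_x_y_comm f p :
  smooth f -> partial_x (partial_y f) p = partial_y (partial_x f) p.
Proof.
destruct p as [[x y] th]; intros sf.
apply (Schwarz (fun u v => f (u, v, th)) x y).
- apply locally_2d_forall; intros u v.
  destruct (smooth_has_partials f (u, v, th) sf) as (fx & fy & ft).
  destruct (smooth_has_partials _ (u, v, th) (smooth_partial_x _ sf)) as (ax & ay & at').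
  destruct (smooth_has_partials _ (u, v, th) (smooth_partial_y _ sf)) as (bx & by' & bt).
  repeat split; assumption.
- apply (continuity_2d_pt_comp3 (partial_x (partial_y f))
    (fun u v => u)
    (fun u v => v)
    (fun u v => th));
    auto using continuity_2d_pt_id1, continuity_2d_pt_id2, continuity_2d_pt_const.
  exact (smooth_continuous _ _ (smooth_partial_x _ (smooth_partial_y _ sf))).
- apply (continuity_2d_pt_comp3 (partial_y (partial_x f))
    (fun u v => u)
    (fun u v => v)
    (fun u v => th));
    auto using continuity_2d_pt_id1, continuity_2d_pt_id2, continuity_2d_pt_const.
  exact (smooth_continuous _ _ (smooth_partial_y _ (smooth_partial_x _ sf))).
Qed.

Lemma partial_x_th_comm f p :
  smooth f -> partial_x (partial_th f) p = partial_th (partial_x f) p.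
Proof.
destruct p as [[x y] th]; intros sf.
apply (Schwarz (fun u v => f (u, y, v)) x th).
- apply locally_2d_forall; intros u v.
  destruct (smooth_has_partials f (u, y, v) sf) as (fx & fy & ft).
  destruct (smooth_has_partials _ (u, y, v) (smooth_partial_x _ sf)) as (ax & ay & at').
  destruct (smooth_has_partials _ (u, y, v) (smooth_partial_th _ sf)) as (bx & by' & bt).
  repeat split; assumption.
- apply (continuity_2d_pt_comp3 (partial_x (partial_th f))
    (fun u v => u)
    (fun u v => y)
    (fun u v => v));
    auto using continuity_2d_pt_id1, continuity_2d_pt_id2, continuity_2d_pt_const.
  exact (smooth_continuous _ _ (smooth_partial_x _ (smooth_partial_th _ sf))).
- apply (continuity_2d_pt_comp3 (partial_th (partial_x f))
    (fun u v => u)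
    (fun u v => y)
    (fun u v => v));
    auto using continuity_2d_pt_id1, continuity_2d_pt_id2, continuity_2d_pt_const.
  exact (smooth_continuous _ _ (smooth_partial_th _ (smooth_partial_x _ sf))).
Qed.

Lemma partial_y_th_comm f p :
  smooth f -> partial_y (partial_th f) p = partial_th (partial_y f) p.
Proof.
destruct p as [[x y] th]; intros sf.
apply (Schwarz (fun u v => f (x, u, v)) y th).
- apply locally_2d_forall; intros u v.
  destruct (smooth_has_partials f (x, u, v) sf) as (fx & fy & ft).
  destruct (smooth_has_partials _ (x, u, v) (smooth_partial_y _ sf)) as (ax & ay & at').
  destruct (smooth_has_partials _ (x, u, v) (smooth_partial_th _ sf)) as (bx & by' & bt).
  repeat split; assumption.
- apply (continuity_2d_pt_comp3 (partial_y (partial_th f))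
    (fun u v => x)
    (fun u v => u)
    (fun u v => v));
    auto using continuity_2d_pt_id1, continuity_2d_pt_id2, continuity_2d_pt_const.
  exact (smooth_continuous _ _ (smooth_partial_y _ (smooth_partial_th _ sf))).
- apply (continuity_2d_pt_comp3 (partial_th (partial_y f))
    (fun u v => x)
    (fun u v => u)
    (fun u v => v));
    auto using continuity_2d_pt_id1, continuity_2d_pt_id2, continuity_2d_pt_const.
  exact (smooth_continuous _ _ (smooth_partial_th _ (smooth_partial_y _ sf))).
Qed.

(** * Functions determined by their partial derivatives *)

Lemma zero_derive_constant (f : R -> R) a b :
  (forall t, is_derive f t 0) -> f a = f b.
Proof.
intros d; destruct (Rtotal_order a b) as [h | [-> | h]].
- exact (eq_is_derive f a b (fun t _ => d t) h).
- reflexivity.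
- symmetry; exact (eq_is_derive f b a (fun t _ => d t) h).
Qed.

(** Moves to the origin along three axis-parallel segments, one coordinate at a
    time. *)
Lemma zero_partials_constant f :
  (forall p, has_partials f p) ->
  (forall p, partial_x f p = 0 /\ partial_y f p = 0 /\ partial_th f p = 0) ->
  forall p, f p = f (0, 0, 0).
Proof.
intros df zf [[x y] th].
transitivity (f (0, y, th)); [|transitivity (f (0, 0, th))].
- apply (zero_derive_constant (fun s => f (s, y, th))); intros t.
  destruct (df (t, y, th)) as (d & _ & _), (zf (t, y, th)) as (z & _ & _).
  exact (eq_ind _ (is_derive _ t) (Derive_correct _ _ d) _ z).
- apply (zero_derive_constant (fun s => f (0, s, th))); intros t.
  destruct (df (0, t, th)) as (_ & d & _), (zf (0, t, th)) as (_ & z & _).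
  exact (eq_ind _ (is_derive _ t) (Derive_correct _ _ d) _ z).
- apply (zero_derive_constant (fun s => f (0, 0, s))); intros t.
  destruct (df (0, 0, t)) as (_ & _ & d), (zf (0, 0, t)) as (_ & _ & z).
  exact (eq_ind _ (is_derive _ t) (Derive_correct _ _ d) _ z).
Qed.

Lemma eq_of_partials f g :
  smooth f -> smooth g ->
  (forall p, partial_x f p = partial_x g p /\ partial_y f p = partial_y g p /\
             partial_th f p = partial_th g p) ->
  f (0, 0, 0) = g (0, 0, 0) -> forall p, f p = g p.
Proof.
intros sf sg e e0.
set (h := fun q => f q + (fun _ => -1) q * g q).
assert (sh : smooth h)
  by (apply smooth_plus; [|apply smooth_mult]; auto using smooth_const).
assert (hc : forall p, h p = h (0, 0, 0)).
{ apply zero_partials_constant.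
  { intros p; apply smooth_has_partials, sh. }
  intros p.
  destruct (partials_mult (fun _ => -1) g p) as (dm & mx & my & mt);
    [apply smooth_has_partials; auto using smooth_const ..|].
  destruct (partials_plus f (fun q => (fun _ => -1) q * g q) p)
    as (_ & hx & hy & ht); [apply smooth_has_partials, sf | exact dm |].
  destruct (partials_const (-1) p) as (_ & cx0 & cy0 & ct0).
  destruct (e p) as (ex & ey & et).
  unfold h; rewrite hx, hy, ht, mx, my, mt, cx0, cy0, ct0, ex, ey, et.
  repeat split; ring. }
intros p; specialize (hc p); unfold h in hc; lra.
Qed.

(** * The equations of an infinitesimal symmetry *)

Definition n2_derivative (f : R3 -> R) (p : R3) : R :=
  partial_x f p + cth p * partial_y f p.

(** The bracket relation [[n1, n2] = d_y], as an identity between differential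
    operators: this is how derivatives along [y] become accessible from the two
    horizontal directions. *)
Lemma partial_th_n2_derivative f p :
  smooth f ->
  partial_th (n2_derivative f) p =
  n2_derivative (partial_th f) p + partial_y f p.
Proof.
intros sf.
assert (sx := smooth_partial_x f sf); assert (sy := smooth_partial_y f sf).
destruct (partials_mult cth (partial_y f) p) as (dm & _ & _ & em);
  [apply smooth_has_partials; auto using smooth_cth ..|].
destruct (partials_plus (partial_x f) (fun q => cth q * partial_y f q) p)
  as (_ & _ & _ & ep); [apply smooth_has_partials; assumption | exact dm |].
unfold n2_derivative; rewrite ep, em.
destruct (partials_cth p) as (_ & _ & _ & ->).
rewrite (partial_x_th_comm f), (partial_y_th_comm f) by assumption; ring.
Qed.

(** Applying [partial_th_n2_derivative] to [b] and to [a] gives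
    [b_y = theta a_y].  Comparing the two mixed derivatives of [b] in [y] and
    [theta] then gives [a_y = 0], after which the system splits into ordinary
    equations in [x] and [theta]. *)
Lemma killing_partials a b c :
  smooth a -> smooth b -> smooth c ->
  (forall p, partial_th c p = 0) ->
  (forall p, n2_derivative a p = 0) ->
  (forall p, partial_th a p + n2_derivative c p = 0) ->
  (forall p, partial_th b p = cth p * partial_th a p) ->
  (forall p, n2_derivative b p = c p) ->
  exists k : R, forall p,
    (partial_x a p = 0 /\ partial_y a p = 0 /\ partial_th a p = k) /\
    (partial_x b p = c p /\ partial_y b p = 0 /\ partial_th b p = k * cth p) /\
    (partial_x c p = - k /\ partial_y c p = 0 /\ partial_th c p = 0).
Proof.
intros sa sb sc c_th n2_a skew b_th n2_b.
assert (zero_partials : forall p, partial_x (fun _ => 0) p = 0 /\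
  partial_y (fun _ => 0) p = 0 /\ partial_th (fun _ => 0) p = 0)
  by (intros p; apply partials_const).
assert (cth_mult : forall f p, smooth f ->
  partial_x (fun q => cth q * f q) p = cth p * partial_x f p /\
  partial_y (fun q => cth q * f q) p = cth p * partial_y f p /\
  partial_th (fun q => cth q * f q) p = f p + cth p * partial_th f p).
{ intros f p sf.
  destruct (partials_mult cth f p) as (_ & -> & -> & ->);
    [apply smooth_has_partials; auto using smooth_cth ..|].
  destruct (partials_cth p) as (_ & -> & -> & ->); repeat split; ring. }
assert (sat := smooth_partial_th a sa); assert (say := smooth_partial_y a sa).
(* derivative of [X a = 0] along theta *)
assert (n2_a_th : forall p, n2_derivative (partial_th a) p = - partial_y a p).
{ intros p; pose proof (partial_th_n2_derivative a p sa) as h.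
  rewrite (functional_extensionality (n2_derivative a) (fun _ => 0) n2_a) in h.
  rewrite (proj2 (proj2 (zero_partials p))) in h; lra. }
(* derivative of [X b = c] along theta, using [c_theta = 0] *)
assert (b_y_a_y : forall p, partial_y b p = cth p * partial_y a p).
{ intros p; pose proof (partial_th_n2_derivative b p sb) as h.
  rewrite (functional_extensionality (n2_derivative b) c n2_b), c_th in h.
  rewrite (functional_extensionality (partial_th b)
    (fun q => cth q * partial_th a q) b_th) in h.
  unfold n2_derivative in h.
  destruct (cth_mult _ p sat) as (ex & ey & _); rewrite ex, ey in h.
  specialize (n2_a_th p); unfold n2_derivative in n2_a_th.
  replace (partial_y a p)
    with (- (partial_x (partial_th a) p + cth p * partial_y (partial_th a) p))
    by lra.
  lra. }
(* [(theta a_y)_theta = b_y_theta = b_theta_y = (theta a_theta)_y], so [a_y = 0] *)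
assert (a_y : forall p, partial_y a p = 0).
{ intros p; pose proof (partial_y_th_comm b p sb) as h.
  rewrite (functional_extensionality (partial_y b)
    (fun q => cth q * partial_y a q) b_y_a_y),
    (functional_extensionality (partial_th b)
    (fun q => cth q * partial_th a q) b_th) in h.
  destruct (cth_mult _ p sat) as (_ & ey & _).
  destruct (cth_mult _ p say) as (_ & _ & et).
  rewrite ey, et, (partial_y_th_comm a) in h by exact sa; lra. }
assert (b_y : forall p, partial_y b p = 0)
  by (intros p; rewrite b_y_a_y, a_y; ring).
assert (a_x : forall p, partial_x a p = 0).
{ intros p; specialize (n2_a p); unfold n2_derivative in n2_a.
  rewrite a_y in n2_a; lra. }
assert (b_x : forall p, partial_x b p = c p).
{ intros p; specialize (n2_b p); unfold n2_derivative in n2_b.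
  rewrite b_y in n2_b; lra. }
assert (c_y : forall p, partial_y c p = 0).
{ intros p.
  rewrite <- (functional_extensionality (partial_x b) c b_x).
  rewrite <- partial_x_y_comm by exact sb.
  rewrite (functional_extensionality (partial_y b) (fun _ => 0) b_y).
  apply zero_partials. }
assert (c_x : forall p, partial_x c p = - partial_th a p).
{ intros p; specialize (skew p); unfold n2_derivative in skew.
  rewrite c_y in skew; lra. }
(* [a_theta = - c_x], where the left side depends on theta only and the right
   side on [x] only *)
assert (a_th : exists k, forall p, partial_th a p = k).
{ exists (partial_th a (0, 0, 0)); apply zero_partials_constant.
  { intros p; apply smooth_has_partials, sat. }
  intros p; repeat split.
  - rewrite partial_x_th_comm by exact sa.
    rewrite (functional_extensionality (partial_x a) (fun _ => 0) a_x).
    apply zero_partials.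
  - rewrite partial_y_th_comm by exact sa.
    rewrite (functional_extensionality (partial_y a) (fun _ => 0) a_y).
    apply zero_partials.
  - assert (e : partial_th a = fun q => (fun _ => -1) q * partial_x c q)
      by (extensionality q; rewrite c_x; ring).
    rewrite e.
    destruct (partials_mult (fun _ => -1) (partial_x c) p) as (_ & _ & _ & ->);
      [apply smooth_has_partials; auto using smooth_const, smooth_partial_x ..|].
    destruct (partials_const (-1) p) as (_ & _ & _ & ->).
    rewrite <- partial_x_th_comm by exact sc.
    rewrite (functional_extensionality (partial_th c) (fun _ => 0) c_th).
    rewrite (proj1 (zero_partials p)); ring. }
destruct a_th as [k a_th]; exists k; intros p.
rewrite a_x, a_y, b_x, b_y, b_th, c_x, c_y, c_th, a_th.
repeat split; ring.
Qed.

(** The infinitesimal symmetries, as a family over their coordinates in the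
    basis [t0], [t1], [t2], [t3]. *)
Definition killing (c0 c1 c2 c3 : R) : vfield :=
  vplus (vplus (vscal c0 t0) (vscal c1 t1)) (vplus (vscal c2 t2) (vscal c3 t3)).

Lemma killingE c0 c1 c2 c3 p :
  killing c0 c1 c2 c3 p =
  (c0 * cth p + c1,
   c0 * ((cth p ^ 2 - cx p ^ 2) / 2) + c2 * cx p + c3,
   - c0 * cx p + c2).
Proof. destruct p as [[x y] th]; heis_calc. Qed.

(** These are the values found in [killing_partials], with [k = c0]. *)
Lemma killing_partialsE c0 c1 c2 c3 p (v := killing c0 c1 c2 c3) :
  (partial_x (fun q => cx (v q)) p = 0 /\
   partial_y (fun q => cx (v q)) p = 0 /\
   partial_th (fun q => cx (v q)) p = c0) /\
  (partial_x (fun q => cy (v q)) p = cth (v p) /\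
   partial_y (fun q => cy (v q)) p = 0 /\
   partial_th (fun q => cy (v q)) p = c0 * cth p) /\
  (partial_x (fun q => cth (v q)) p = - c0 /\
   partial_y (fun q => cth (v q)) p = 0 /\
   partial_th (fun q => cth (v q)) p = 0).
Proof.
subst v; destruct p as [[x y] th]; repeat split; heis_calc.
Qed.

Lemma smooth_killing c0 c1 c2 c3 : smooth_field (killing c0 c1 c2 c3).
Proof.
split; [|split].
- apply smooth_ext with (fun p => c0 * cth p + c1);
    [intros p; cbv beta; rewrite killingE; reflexivity|].
  apply smooth_plus; [apply smooth_mult|]; auto using smooth_const, smooth_cth.
- apply smooth_ext with (fun p =>
    c0 / 2 * (cth p * cth p - cx p * cx p) + (c2 * cx p + c3)).
  { intros p; cbv beta; rewrite killingE; cbn; field. }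
  repeat first [apply smooth_minus | apply smooth_plus | apply smooth_mult];
    auto using smooth_const, smooth_cth, smooth_cx.
- apply smooth_ext with (fun p => - c0 * cx p + c2);
    [intros p; cbv beta; rewrite killingE; reflexivity|].
  apply smooth_plus; [apply smooth_mult|]; auto using smooth_const, smooth_cx.
Qed.

(** The free constants are the rotation rate and the value at the origin, where
    [t0] vanishes and [t1], [t2], [t3] form the coordinate frame. *)
Lemma killing_solution v :
  smooth_field v ->
  (forall p, partial_th (fun q => cth (v q)) p = 0) ->
  (forall p, n2_derivative (fun q => cx (v q)) p = 0) ->
  (forall p, partial_th (fun q => cx (v q)) p +
             n2_derivative (fun q => cth (v q)) p = 0) ->
  (forall p, partial_th (fun q => cy (v q)) p =
             cth p * partial_th (fun q => cx (v q)) p) ->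
  (forall p, n2_derivative (fun q => cy (v q)) p = cth (v p)) ->
  exists c0 c1 c2 c3, forall p, v p = killing c0 c1 c2 c3 p.
Proof.
intros (sa & sb & sc) c_th n2_a skew b_th n2_b.
destruct (killing_partials _ _ _ sa sb sc c_th n2_a skew b_th n2_b) as [k e].
exists k, (cx (v (0, 0, 0))), (cth (v (0, 0, 0))), (cy (v (0, 0, 0))).
set (u := killing _ _ _ _).
destruct (smooth_killing k (cx (v (0, 0, 0))) (cth (v (0, 0, 0)))
            (cy (v (0, 0, 0)))) as (ua & ub & uc).
fold u in ua, ub, uc.
assert (u0 : u (0, 0, 0) = v (0, 0, 0)).
{ unfold u; rewrite killingE; apply R3_eq; cbn; field. }
assert (d := killing_partialsE k (cx (v (0, 0, 0))) (cth (v (0, 0, 0)))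
               (cy (v (0, 0, 0)))); cbv zeta in d; fold u in d.
assert (ec : forall p, cth (v p) = cth (u p)).
{ apply (eq_of_partials _ _ sc uc); [|rewrite u0; reflexivity].
  intros p; destruct (e p) as (_ & _ & -> & -> & ->).
  destruct (d p) as (_ & _ & -> & -> & ->); auto. }
intros p; apply R3_eq; [| |apply ec]; revert p.
- apply (eq_of_partials _ _ sa ua); [|rewrite u0; reflexivity].
  intros p; destruct (e p) as ((-> & -> & ->) & _).
  destruct (d p) as ((-> & -> & ->) & _); auto.
- apply (eq_of_partials _ _ sb ub); [|rewrite u0; reflexivity].
  intros p; destruct (e p) as (_ & (-> & -> & ->) & _).
  destruct (d p) as (_ & (-> & -> & ->) & _); auto.
Qed.

(** * Infinitesimal symmetries of the Heisenberg structure *)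

(** The distribution is the kernel of the contact form [dy - theta dx]. *)
Lemma heis_D_iff p xi : heis_D p xi <-> cy xi = cth p * cx xi.
Proof.
split.
- intros (a & b & ->); destruct p as [[x y] th]; cbn; ring.
- intros h; exists (cth xi), (cx xi).
  destruct p as [[x y] th], xi as [[a b] c]; apply R3_eq; cbn in *;
    rewrite ?h; ring.
Qed.

Lemma n2E : n2 = fun p => (1, cth p, 0).
Proof. extensionality p; destruct p as [[x y] th]; heis_calc. Qed.

Lemma n1_section : smooth_section heis_D n1.
Proof.
split; [split; [|split]; exact (smooth_const _)|].
intros p; apply heis_D_iff; cbn; ring.
Qed.

Lemma n2_section : smooth_section heis_D n2.
Proof.
rewrite n2E; split.
- exact (conj (smooth_const 1) (conj smooth_cth (smooth_const 0))).
- intros p; apply heis_D_iff; cbn; ring.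
Qed.

Lemma bracketE v w p :
  bracket v w p =
  (differential (fun q => cx (w q)) p (v p) - differential (fun q => cx (v q)) p (w p),
   differential (fun q => cy (w q)) p (v p) - differential (fun q => cy (v q)) p (w p),
   differential (fun q => cth (w q)) p (v p) - differential (fun q => cth (v q)) p (w p)).
Proof. reflexivity. Qed.

Lemma differential_n1 f p : differential f p (n1 p) = partial_th f p.
Proof. unfold differential; cbn; ring. Qed.

Lemma differential_n2 f p : differential f p (n2 p) = n2_derivative f p.
Proof. rewrite n2E; unfold differential, n2_derivative; cbn; ring. Qed.

Lemma bracket_n1 v p :
  bracket v n1 p =
  (- partial_th (fun q => cx (v q)) p, - partial_th (fun q => cy (v q)) p,
   - partial_th (fun q => cth (v q)) p).
Proof.
rewrite bracketE, !differential_n1; cbn [n1 d_th cx cy cth fst snd].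
rewrite !differential_const; apply R3_eq; cbn; ring.
Qed.

Lemma bracket_n2 v p :
  bracket v n2 p =
  (- n2_derivative (fun q => cx (v q)) p,
   cth (v p) - n2_derivative (fun q => cy (v q)) p,
   - n2_derivative (fun q => cth (v q)) p).
Proof.
rewrite bracketE, !differential_n2, n2E.
change (fun q : R3 => cx (1, cth q, 0)) with (fun _ : R3 => 1).
change (fun q : R3 => cy (1, cth q, 0)) with cth.
change (fun q : R3 => cth (1, cth q, 0)) with (fun _ : R3 => 0).
rewrite !differential_const, differential_cth; apply R3_eq; cbn; ring.
Qed.

(** Only the brackets with [n1] and [n2] are used.  Their inner products are
    constant, so the derivative term of the metric condition drops out. *)
Lemma symmetry_killing v :
  infinitesimal_symmetry heis_D heis_r v ->
  exists c0 c1 c2 c3, forall p, v p = killing c0 c1 c2 c3 p.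
Proof.
intros (sv & hD & hr).
assert (skew : forall w1 w2 c,
  smooth_section heis_D w1 -> smooth_section heis_D w2 ->
  (forall q, heis_r q (w1 q) (w2 q) = c) -> forall p,
  heis_r p (bracket v w1 p) (w2 p) + heis_r p (w1 p) (bracket v w2 p) = 0).
{ intros w1 w2 c s1 s2 hc p; pose proof (hr w1 w2 s1 s2 p) as h.
  unfold lie_derivative_metric in h.
  rewrite (functional_extensionality (fun q => heis_r q (w1 q) (w2 q))
    (fun _ => c) hc), differential_const in h; lra. }
assert (on_frame : forall p,
  partial_th (fun q => cy (v q)) p = cth p * partial_th (fun q => cx (v q)) p /\
  n2_derivative (fun q => cy (v q)) p - cth (v p) =
    cth p * n2_derivative (fun q => cx (v q)) p /\
  partial_th (fun q => cth (v q)) p = 0 /\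
  n2_derivative (fun q => cx (v q)) p = 0 /\
  partial_th (fun q => cx (v q)) p + n2_derivative (fun q => cth (v q)) p = 0).
{ intros p.
  pose proof (proj1 (heis_D_iff _ _) (proj2 (hD n1 n1_section) p)) as D1.
  pose proof (proj1 (heis_D_iff _ _) (proj2 (hD n2 n2_section) p)) as D2.
  pose proof (fun q => proj1 (n1_n2_orthonormal q)) as o11.
  pose proof (fun q => proj1 (proj2 (n1_n2_orthonormal q))) as o22.
  pose proof (fun q => proj2 (proj2 (n1_n2_orthonormal q))) as o12.
  pose proof (skew _ _ _ n1_section n1_section o11 p) as r11.
  pose proof (skew _ _ _ n2_section n2_section o22 p) as r22.
  pose proof (skew _ _ _ n1_section n2_section o12 p) as r12.
  rewrite bracket_n1 in D1, r11, r12; rewrite bracket_n2 in D2, r22, r12.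
  rewrite n2E in r12, r22; unfold heis_r in r11, r12, r22.
  cbn [n1 d_th cx cy cth fst snd] in D1, D2, r11, r12, r22.
  lra. }
apply killing_solution; [exact sv| ..]; intros p;
  destruct (on_frame p) as (D1 & D2 & r11 & r22 & r12); try assumption.
rewrite r22 in D2; lra.
Qed.

Lemma differential_killing c0 c1 c2 c3 p xi (v := killing c0 c1 c2 c3) :
  differential (fun q => cx (v q)) p xi = c0 * cth xi /\
  differential (fun q => cy (v q)) p xi =
    cth (v p) * cx xi + c0 * cth p * cth xi /\
  differential (fun q => cth (v q)) p xi = - c0 * cx xi.
Proof.
destruct (killing_partialsE c0 c1 c2 c3 p)
  as ((ax & ay & at') & (bx & by' & bt) & ctx & cty & ctt).
unfold differential; subst v.
rewrite ax, ay, at', bx, by', bt, ctx, cty, ctt; repeat split; ring.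
Qed.

(** Along an arbitrary section the Leibniz rule leaves only derivatives of [v],
    which cancel: in the metric because [(c0 xi_theta, - c0 xi_x)] is skew in
    [(xi_x, xi_theta)], in the distribution because the theta-component of [v]
    enters both through [d (theta)] and through the derivative of its
    [y]-component. *)
Lemma killing_symmetry c0 c1 c2 c3 :
  infinitesimal_symmetry heis_D heis_r (killing c0 c1 c2 c3).
Proof.
set (v := killing c0 c1 c2 c3).
assert (dv : forall p xi, _) by exact (differential_killing c0 c1 c2 c3).
cbv zeta in dv; fold v in dv.
split; [apply smooth_killing|split].
- intros w (sw & hw); split; [apply smooth_field_bracket;
    [apply smooth_killing | exact sw]|].
  intros p; apply heis_D_iff; rewrite bracketE; cbn [cx cy cth fst snd].
  destruct (dv p (w p)) as (-> & -> & _).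
  assert (ew : (fun q => cy (w q)) = fun q => cth q * cx (w q))
    by (extensionality q; apply heis_D_iff, hw).
  rewrite ew, (differential_mult cth (fun q => cx (w q)))
    by (apply smooth_cth || apply sw).
  rewrite differential_cth; ring.
- intros w1 w2 ((s1x & _ & s1t) & _) ((s2x & _ & s2t) & _) p.
  unfold lie_derivative_metric, heis_r.
  rewrite (differential_plus (fun q => cx (w1 q) * cx (w2 q))
    (fun q => cth (w1 q) * cth (w2 q))) by (apply smooth_mult; assumption).
  rewrite (differential_mult (fun q => cx (w1 q)) (fun q => cx (w2 q))),
    (differential_mult (fun q => cth (w1 q)) (fun q => cth (w2 q)))
    by assumption.
  rewrite !bracketE; cbn [cx cy cth fst snd].
  destruct (dv p (w1 p)) as (-> & _ & ->), (dv p (w2 p)) as (-> & _ & ->).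
  ring.
Qed.

(** * The Lie algebra *)

Lemma killing_ext v c0 c1 c2 c3 :
  (forall p, v p = killing c0 c1 c2 c3 p) -> v = killing c0 c1 c2 c3.
Proof. intros e; extensionality p; apply e. Qed.

Lemma killing_zero : vzero = killing 0 0 0 0.
Proof. apply killing_ext; intros p; rewrite killingE; apply R3_eq; cbn; field. Qed.

Lemma killing_plus a0 a1 a2 a3 b0 b1 b2 b3 :
  vplus (killing a0 a1 a2 a3) (killing b0 b1 b2 b3) =
  killing (a0 + b0) (a1 + b1) (a2 + b2) (a3 + b3).
Proof.
apply killing_ext; intros p; unfold vplus at 1; rewrite !killingE.
apply R3_eq; cbn; field.
Qed.

Lemma killing_scal k c0 c1 c2 c3 :
  vscal k (killing c0 c1 c2 c3) = killing (k * c0) (k * c1) (k * c2) (k * c3).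
Proof.
apply killing_ext; intros p; unfold vscal at 1; rewrite !killingE.
apply R3_eq; cbn; field.
Qed.

(** The structure constants [[t0, t1] = t2], [[t0, t2] = - t1], [[t1, t2] = t3],
    with [t3] central. *)
Lemma killing_bracket a0 a1 a2 a3 b0 b1 b2 b3 :
  bracket (killing a0 a1 a2 a3) (killing b0 b1 b2 b3) =
  killing 0 (a2 * b0 - a0 * b2) (a0 * b1 - a1 * b0) (a1 * b2 - a2 * b1).
Proof.
apply killing_ext; intros p; rewrite bracketE.
destruct (differential_killing b0 b1 b2 b3 p (killing a0 a1 a2 a3 p))
  as (-> & -> & ->).
destruct (differential_killing a0 a1 a2 a3 p (killing b0 b1 b2 b3 p))
  as (-> & -> & ->).
rewrite !killingE; apply R3_eq; cbn; field.
Qed.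

(** The identities of a Lie algebra pass to any class of members of the family,
    so that for a concrete class only the closure properties are left. *)
Lemma lie_algebra_of_killing (S : vfield -> Prop) :
  (forall v, S v -> exists c0 c1 c2 c3, v = killing c0 c1 c2 c3) ->
  S vzero ->
  (forall v w, S v -> S w -> S (vplus v w)) ->
  (forall c v, S v -> S (vscal c v)) ->
  (forall v w, S v -> S w -> S (bracket v w)) ->
  lie_algebra S.
Proof.
intros hS S0 Sp Ss Sb; split; try assumption.
- intros a b u v w hu hv hw p.
  destruct (hS u hu) as (u0 & u1 & u2 & u3 & ->),
    (hS v hv) as (v0 & v1 & v2 & v3 & ->), (hS w hw) as (w0 & w1 & w2 & w3 & ->).
  rewrite !killing_scal, killing_plus, !killing_bracket, !killing_scal, killing_plus.
  f_equal; ring.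
- intros a b u v w hu hv hw p.
  destruct (hS u hu) as (u0 & u1 & u2 & u3 & ->),
    (hS v hv) as (v0 & v1 & v2 & v3 & ->), (hS w hw) as (w0 & w1 & w2 & w3 & ->).
  rewrite !killing_scal, killing_plus, !killing_bracket, !killing_scal, killing_plus.
  f_equal; ring.
- intros v hv p; destruct (hS v hv) as (v0 & v1 & v2 & v3 & ->).
  rewrite killing_bracket; change zero with (vzero p); rewrite killing_zero.
  f_equal; ring.
- intros u v w hu hv hw p.
  destruct (hS u hu) as (u0 & u1 & u2 & u3 & ->),
    (hS v hv) as (v0 & v1 & v2 & v3 & ->), (hS w hw) as (w0 & w1 & w2 & w3 & ->).
  rewrite !killing_bracket, !killing_plus.
  change zero with (vzero p); rewrite killing_zero.
  f_equal; ring.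
Qed.

Lemma symmetry_iff v :
  infinitesimal_symmetry heis_D heis_r v <->
  exists c0 c1 c2 c3, v = killing c0 c1 c2 c3.
Proof.
split.
- intros h; destruct (symmetry_killing v h) as (c0 & c1 & c2 & c3 & e).
  exists c0, c1, c2, c3; apply killing_ext, e.
- intros (c0 & c1 & c2 & c3 & ->); apply killing_symmetry.
Qed.

Lemma isotropy_iff v :
  isotropy heis_D heis_r (0, 0, 0) v <-> exists c, v = killing c 0 0 0.
Proof.
split.
- intros [h v0]; apply symmetry_iff in h; destruct h as (c0 & c1 & c2 & c3 & ->).
  rewrite killingE in v0; injection v0; cbn; intros e2 e3 e1.
  exists c0; f_equal; lra.
- intros [c ->]; split; [apply killing_symmetry|].
  rewrite killingE; apply R3_eq; cbn; field.
Qed.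

Lemma lie_algebra_symmetry : lie_algebra (infinitesimal_symmetry heis_D heis_r).
Proof.
apply lie_algebra_of_killing.
- intros v; apply symmetry_iff.
- rewrite killing_zero; apply killing_symmetry.
- intros v w hv hw; apply symmetry_iff in hv, hw.
  destruct hv as (v0 & v1 & v2 & v3 & ->), hw as (w0 & w1 & w2 & w3 & ->).
  rewrite killing_plus; apply killing_symmetry.
- intros c v hv; apply symmetry_iff in hv; destruct hv as (v0 & v1 & v2 & v3 & ->).
  rewrite killing_scal; apply killing_symmetry.
- intros v w hv hw; apply symmetry_iff in hv, hw.
  destruct hv as (v0 & v1 & v2 & v3 & ->), hw as (w0 & w1 & w2 & w3 & ->).
  rewrite killing_bracket; apply killing_symmetry.
Qed.

Lemma lie_algebra_isotropy : lie_algebra (isotropy heis_D heis_r (0, 0, 0)).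
Proof.
apply lie_algebra_of_killing.
- intros v [h _]; apply symmetry_iff, h.
- apply isotropy_iff; exists 0; apply killing_zero.
- intros v w hv hw; apply isotropy_iff in hv, hw.
  destruct hv as [a ->], hw as [b ->]; apply isotropy_iff; exists (a + b).
  rewrite killing_plus; f_equal; ring.
- intros c v hv; apply isotropy_iff in hv; destruct hv as [a ->].
  apply isotropy_iff; exists (c * a); rewrite killing_scal; f_equal; ring.
- intros v w hv hw; apply isotropy_iff in hv, hw.
  destruct hv as [a ->], hw as [b ->]; apply isotropy_iff; exists 0.
  rewrite killing_bracket; f_equal; ring.
Qed.

(** * Translations and right-invariant fields *)

Lemma is_derive_line (p xi : R3) (s : R) :
  is_derive (fun u : R => plus p (scal u xi)) s xi.
Proof.
evar_last.
- apply @is_derive_plus; [apply is_derive_const|].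
  apply (is_derive_scal_l (fun u : R => u) s 1 xi (is_derive_id s)).
- rewrite plus_zero_l; apply (scal_one xi).
Qed.

(** For the Heisenberg law in these coordinates the one-parameter subgroup with
    velocity a coordinate vector is a straight line, and so are the orbits of
    its left translations, since [v] is constant along them. *)
Lemma line_generates_translations (v : vfield) (xi : R3) :
  (forall s s', scal (s + s') xi = heis_mul (scal s xi) (scal s' xi)) ->
  (forall s p, heis_mul (scal s xi) p = plus p (scal s (v p))) ->
  (forall s p, v (heis_mul (scal s xi) p) = v p) ->
  generates_translations v.
Proof.
intros hom flow inv; exists (fun s => scal s xi); split; [|split].
- apply (scal_zero_l xi).
- exact hom.
- intros p s; rewrite inv.
  apply (is_derive_ext (fun u : R => plus p (scal u (v p)))).
  + intros u; symmetry; apply flow.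
  + apply is_derive_line.
Qed.

Lemma t_generate_translations :
  generates_translations t1 /\ generates_translations t2 /\
  generates_translations t3.
Proof.
repeat split;
  [apply (line_generates_translations _ (1, 0, 0))
  |apply (line_generates_translations _ (0, 0, 1))
  |apply (line_generates_translations _ (0, 1, 0))];
  intros; apply R3_eq; cbn; unfold cx, cy, cth; ring.
Qed.

Lemma Tmap_right_translation g p xi :
  Tmap (fun q => heis_mul q g) p xi = (cx xi, cy xi + cth xi * cx g, cth xi).
Proof.
destruct g as [[gx gy] gt], p as [[x y] th], xi as [[a b] c]; heis_calc.
Qed.

(** Right translation carries the identity to any given point, so a
    right-invariant field is determined by its value at the origin. *)
Lemma right_invariant_iff w :
  right_invariant w <-> exists c1 c2 c3, w = killing 0 c1 c2 c3.
Proof.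
split.
- intros h; exists (cx (w (0, 0, 0))), (cth (w (0, 0, 0))), (cy (w (0, 0, 0))).
  apply killing_ext; intros p.
  transitivity (w (heis_mul (0, 0, 0) p)).
  { f_equal; apply R3_eq; cbn; ring. }
  rewrite <- h, Tmap_right_translation, killingE; apply R3_eq; cbn; field.
- intros (c1 & c2 & c3 & ->) g p.
  rewrite Tmap_right_translation, !killingE; apply R3_eq; cbn; field.
Qed.

Theorem proposition4p1 :
  (lie_algebra (infinitesimal_symmetry heis_D heis_r) /\
   forall v : vfield,
     infinitesimal_symmetry heis_D heis_r v <->
     exists c0 c1 c2 c3 : R, forall p : R3,
       v p = vplus (vplus (vscal c0 t0) (vscal c1 t1))
                   (vplus (vscal c2 t2) (vscal c3 t3)) p) /\
  (lie_algebra (isotropy heis_D heis_r (0, 0, 0)) /\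
   forall v : vfield,
     isotropy heis_D heis_r (0, 0, 0) v <->
     exists c : R, forall p : R3, v p = vscal c t0 p) /\
  (generates_translations t1 /\ generates_translations t2 /\
   generates_translations t3) /\
  (forall p : R3, bracket t1 t2 p = t3 p /\ bracket t1 t3 p = zero /\
                  bracket t2 t3 p = zero) /\
  (forall p : R3, t1 p = d_x p /\
                  t2 p = plus (d_th p) (scal (cx p) (d_y p)) /\
                  t3 p = d_y p) /\
  (right_invariant t1 /\ right_invariant t2 /\ right_invariant t3) /\
  (forall w : vfield,
     right_invariant w <->
     exists c1 c2 c3 : R, forall p : R3,
       w p = vplus (vplus (vscal c1 t1) (vscal c2 t2)) (vscal c3 t3) p).
Proof.
assert (no_rotation : forall c1 c2 c3 p, killing 0 c1 c2 c3 p =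
  vplus (vplus (vscal c1 t1) (vscal c2 t2)) (vscal c3 t3) p).
{ intros c1 c2 c3 p; rewrite killingE; apply R3_eq; cbn; field. }
assert (rotation : forall c p, killing c 0 0 0 p = vscal c t0 p).
{ intros c p; rewrite killingE; apply R3_eq; cbn; field. }
assert (t1E : t1 = killing 0 1 0 0)
  by (apply killing_ext; intros p; rewrite no_rotation; apply R3_eq; cbn; ring).
assert (t2E : t2 = killing 0 0 1 0)
  by (apply killing_ext; intros p; rewrite no_rotation; apply R3_eq; cbn; ring).
assert (t3E : t3 = killing 0 0 0 1)
  by (apply killing_ext; intros p; rewrite no_rotation; apply R3_eq; cbn; ring).
assert (zeroE : forall p, zero = killing 0 0 0 0 p)
  by (intros p; rewrite <- killing_zero; reflexivity).
split; [|split; [|split; [|split; [|split; [|split]]]]].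
- split; [exact lie_algebra_symmetry|].
  intros v; rewrite symmetry_iff; split; intros (c0 & c1 & c2 & c3 & e);
    exists c0, c1, c2, c3; [rewrite e; reflexivity | apply killing_ext, e].
- split; [exact lie_algebra_isotropy|].
  intros v; rewrite isotropy_iff; split; intros [c e]; exists c.
  + intros p; rewrite e; apply rotation.
  + apply killing_ext; intros p; rewrite e, rotation; reflexivity.
- exact t_generate_translations.
- intros p; rewrite (zeroE p), t1E, t2E, t3E, !killing_bracket.
  repeat split; f_equal; ring.
- intros p; repeat split; apply R3_eq; cbn; ring.
- repeat split; apply right_invariant_iff;
    [exists 1, 0, 0 | exists 0, 1, 0 | exists 0, 0, 1]; assumption.
- intros w; rewrite right_invariant_iff; split; intros (c1 & c2 & c3 & e);
    exists c1, c2, c3.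
  + intros p; rewrite e; apply no_rotation.
  + apply killing_ext; intros p; rewrite e, no_rotation; reflexivity.
Qed.
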